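(* Let $q = p^r$ be a prime power ($p$ prime, $r \ge 1$) and let $n \ge 1$ be an integer. For integers $d \ge q-1$, the probability distribution of the number of zeros in $\mathbb{F}_q^n$ of a uniformly random polynomial in $\mathbb{F}_q[x_1, \ldots, x_n]_{(d,\ldots,d)}$ is independent of $d$. That is, if $X_{n,d}$ denotes the number of zeros in $\mathbb{F}_q^n$ of such a random polynomial, then for all integers $d, d' \ge q-1$ and all integers $k \ge 0$, $P(X_{n,d} = k) = P(X_{n,d'} = k)$.
   Context: $\mathbb{F}_q$ is the finite field with $q$ elements. For $d \ge 0$, $\mathbb{F}_q[x_1,\ldots,x_n]_{(d,\ldots,d)}$ denotes the set of polynomials in $n$ variables over $\mathbb{F}_q$ whose degree in each variable $x_i$ is at most $d$ (including the zero polynomial); it is an $\mathbb{F}_q$-vector space of dimension $(d+1)^n$. A random polynomial is chosen uniformly from this finite set. A zero of $f$ is a point $\mathbf{p} \in \mathbb{F}_q^n$ with $f(\mathbf{p}) = 0$; zeros are counted without multiplicity. *)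

(* Defs.v *)
From HB Require Import structures.
From mathcomp Require Import all_boot all_order all_algebra.
From mathcomp Require Import mpoly.

Set Implicit Arguments.
Unset Strict Implicit.
Unset Printing Implicit Defensive.

Import GRing.Theory.
Local Open Scope ring_scope.

(* The degree of the zero polynomial is 0 here, so that it satisfies every
   bound on the degrees. *)
Definition degvar (R : nzRingType) (n : nat) (i : 'I_n) (f : {mpoly R[n]}) : nat :=
  (\max_(m <- msupp f) m i)%N.

Record boxpoly (R : nzRingType) (n d : nat) := BoxPoly {
  boxpoly_val :> {mpoly R[n]};
  _ : [forall i : 'I_n, (degvar i boxpoly_val <= d)%N]
}.

HB.instance Definition _ (R : nzRingType) (n d : nat) :=
  [isSub for @boxpoly_val R n d].
HB.instance Definition _ (R : nzRingType) (n d : nat) :=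
  [Choice of boxpoly R n d by <:].

Section BoxPolyFinite.
Context (F : finFieldType) (n d : nat).

(* Coefficients are indexed by the exponent vectors in {0, ..., d}^n. *)
Definition expo_mnm (e : {ffun 'I_n -> 'I_d.+1}) : 'X_{1..n} :=
  [multinom (e i : nat) | i < n].

Lemma expo_mnm_inj : injective expo_mnm.
Proof.
move=> e1 e2 /mnmP eq12; apply/ffunP=> i; apply/val_inj.
by have := eq12 i; rewrite !mnmE.
Qed.

Lemma degvarP (f : {mpoly F[n]}) :
  reflect (forall m i, m \in msupp f -> (m i <= d)%N)
          [forall i : 'I_n, (degvar i f <= d)%N].
Proof.
apply: (iffP forallP) => [le_d m i mf | le_d i]; last first.
  by apply/bigmax_leqP_seq=> m mf _; apply: le_d.
by have /bigmax_leqP_seq := le_d i; apply.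
Qed.

Definition boxpoly_coeffs (f : boxpoly F n d) :
    {ffun {ffun 'I_n -> 'I_d.+1} -> F} :=
  [ffun e => (boxpoly_val f)@_(expo_mnm e)].

Definition mpoly_of_coeffs (c : {ffun {ffun 'I_n -> 'I_d.+1} -> F}) :
    {mpoly F[n]} :=
  \sum_(e : {ffun 'I_n -> 'I_d.+1}) c e *: 'X_[expo_mnm e].

Lemma mpoly_of_coeffsE c e : (mpoly_of_coeffs c)@_(expo_mnm e) = c e.
Proof.
rewrite raddf_sum (bigD1 e) //= mcoeffZ mcoeffX eqxx mulr1 big1 ?addr0 // => e' ne.
by rewrite mcoeffZ mcoeffX (inj_eq expo_mnm_inj) (negPf ne) mulr0.
Qed.

Lemma mpoly_of_coeffs_box c :
  [forall i : 'I_n, (degvar i (mpoly_of_coeffs c) <= d)%N].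
Proof.
apply/degvarP=> m i; rewrite mcoeff_msupp => nz.
have /existsP[e /eqP Em] : [exists e, expo_mnm e == m].
  apply: contraR nz; rewrite negb_exists => /forallP nE.
  rewrite raddf_sum big1 // => e _ /=.
  by rewrite mcoeffZ mcoeffX (negPf (nE e)) mulr0.
by rewrite -Em mnmE -ltnS.
Qed.

Definition boxpoly_of_coeffs c : boxpoly F n d := BoxPoly (mpoly_of_coeffs_box c).

Lemma boxpoly_coeffsK : cancel boxpoly_coeffs boxpoly_of_coeffs.
Proof.
move=> f; apply/val_inj/mpolyP=> m /=; case: (boolP [exists e, expo_mnm e == m]).
  by case/existsP=> e /eqP <-; rewrite mpoly_of_coeffsE ffunE.
rewrite negb_exists => /forallP nE.
rewrite /mpoly_of_coeffs raddf_sum big1 => [|e _] /=; last first.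
  by rewrite mcoeffZ mcoeffX (negPf (nE e)) mulr0.
apply/esym/eqP; apply: contraT; rewrite -mcoeff_msupp => mf.
have le_d := degvarP _ (valP f) m _ mf.
have /eqP[] := nE [ffun i => inord (m i)].
by apply/mnmP=> i; rewrite mnmE ffunE inordK // ltnS; apply: le_d.
Qed.

Lemma boxpoly_of_coeffsK : cancel boxpoly_of_coeffs boxpoly_coeffs.
Proof. by move=> c; apply/ffunP=> e; rewrite ffunE mpoly_of_coeffsE. Qed.

HB.instance Definition _ : isCountable (boxpoly F n d) := CanIsCountable boxpoly_coeffsK.
HB.instance Definition _ : isFinite (boxpoly F n d) := CanIsFinite boxpoly_coeffsK.

Lemma card_boxpoly : #|{: boxpoly F n d}| = (#|F| ^ ((d.+1) ^ n))%N.
Proof.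
have bij : bijective boxpoly_coeffs.
  by exists boxpoly_of_coeffs; [exact: boxpoly_coeffsK|exact: boxpoly_of_coeffsK].
by rewrite (bij_eq_card bij) !card_ffun !card_ord.
Qed.

End BoxPolyFinite.

Definition zeros (F : finFieldType) (n : nat) (f : {mpoly F[n]}) :
    {set {ffun 'I_n -> F}} :=
  [set v : {ffun 'I_n -> F} | f.@[v] == 0].

Definition unif_prob (T : finType) (E : pred T) : rat :=
  #|[set x | E x]|%:R / #|T|%:R.

Definition nzeros_law (F : finFieldType) (n d k : nat) : rat :=
  unif_prob (fun f : boxpoly F n d => #|zeros f| == k).

(* Main.v *)
Require Import Defs.
From HB Require Import structures.
From mathcomp Require Import all_boot all_order all_algebra.
From mathcomp Require Import finfield mpoly.

Set Implicit Arguments.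
Unset Strict Implicit.
Unset Printing Implicit Defensive.

Import GRing.Theory.
Local Open Scope ring_scope.

(** Let q be the size of F. As soon as d >= q - 1, every function from F^n to F
    is the evaluation of a polynomial of degree at most d in each variable: the
    indicator of a point v is the product over i of the polynomials
    1 - (x_i - v_i)^(q-1), by Fermat's little theorem
    ([indicator_poly], [evalc_surj]). Evaluation at all the points is thus a
    surjective homomorphism between finite groups, so its fibres all have the
    same size and it carries the uniform distribution on polynomials to the
    uniform distribution on functions F^n -> F ([unif_prob_morph]). The number
    of zeros of f only depends on the function that f defines, so its law is
    that of the number of zeros of a uniformly random function
    ([nzeros_law_random_function]), and this law does not mention d. *)

(** The fibres of f are the translates of its kernel. *)
Lemma card_fibre (V W : finZmodType) (f : {additive V -> W}) (v : V) :
  #|[set u | f u == f v]| = #|[set u | f u == 0]|.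
Proof.
rewrite -[RHS](card_imset _ (addIr v)); apply: eq_card => u.
rewrite inE; apply/eqP/imsetP => [fu | [w]].
  by exists (u - v); rewrite ?subrK // inE raddfB fu subrr.
by rewrite inE => /eqP fw ->; rewrite raddfD /= fw add0r.
Qed.

(** As all the fibres of f have the same size, f preserves uniformity. *)
Lemma unif_prob_morph (V W : finZmodType) (f : {additive V -> W}) (P : pred W) :
  (forall w, exists v, f v = w) ->
  unif_prob (fun v => P (f v)) = unif_prob P.
Proof.
move=> f_surj; set K := #|[set u | f u == 0]|.
have card_preim (Q : pred W) : #|[set v | Q (f v)]| = (#|[set w | Q w]| * K)%N.
  rewrite -sum1_card (partition_big f Q) => [|v]; last by rewrite inE.
  rewrite -sum_nat_const; apply: eq_big => [w | w Qw]; first by rewrite inE.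
  have [v0 fv0] := f_surj w; rewrite /K -(card_fibre f v0) -sum1_card.
  apply: eq_bigl => v; rewrite !inE fv0.
  by case: eqP => [->|]; rewrite ?Qw ?andbF.
have K_neq0 : K%:R != 0 :> rat.
  rewrite Num.Theory.pnatr_eq0 -lt0n card_gt0; apply/set0Pn; exists 0.
  by rewrite inE raddf0.
have card_full (T : finType) : #|T| = #|[set x : T | predT x]|.
  by apply: eq_card => x; rewrite inE.
rewrite /unif_prob [#|V|]card_full [#|W|]card_full.
rewrite (card_preim P) (card_preim predT) !natrM.
by rewrite -mulf_div divff ?mulr1.
Qed.

Lemma unif_prob_bij (S T : finType) (h : S -> T) (P : pred T) :
  bijective h -> unif_prob (fun x => P (h x)) = unif_prob P.
Proof.
move=> h_bij; rewrite /unif_prob (bij_eq_card h_bij); congr (_%:R / _).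
rewrite -(on_card_preimset (onW_bij _ h_bij)).
by apply: eq_card => x; rewrite !inE.
Qed.

Definition indicator_poly (F : finFieldType) (a : F) : {poly F} :=
  1 - ('X - a%:P) ^+ #|F|.-1.

Lemma size_indicator_poly (F : finFieldType) (a : F) :
  (size (indicator_poly a) <= #|F|)%N.
Proof.
have q_gt0 : (0 < #|F|)%N := ltnW (finNzRing_gt1 F).
rewrite (leq_trans (size_polyD _ _)) // size_polyN size_exp_XsubC prednK //.
by rewrite size_poly1 geq_max q_gt0 leqnn.
Qed.

(** A nonzero element of F is a root of x^(q-1) = 1. *)
Lemma horner_indicator_poly (F : finFieldType) (a b : F) :
  (indicator_poly a).[b] = (a == b)%:R.
Proof.
rewrite /indicator_poly !hornerE.
have [<-|ne_ab] := eqVneq a b.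
  by rewrite subrr expr0n -subn1 subn_eq0 leqNgt finNzRing_gt1 subr0.
have nz : b - a != 0 by rewrite subr_eq0 eq_sym.
have q_gt0 : (0 < #|F|)%N := ltnW (finNzRing_gt1 F).
suff -> : (b - a) ^+ #|F|.-1 = 1 by rewrite subrr.
by apply: (mulfI nz); rewrite -exprS prednK // expf_card mulr1.
Qed.

HB.instance Definition _ (T : finType) (V : finZmodType) :=
  Finite.on {ffun T -> V}.

Section Evaluation.
Context (F : finFieldType) (n d : nat).

(** Evaluation is defined on the coefficient families, which form a finite
    additive group; they are in bijection with the polynomials. *)
Definition evalc (c : {ffun {ffun 'I_n -> 'I_d.+1} -> F}) :
    {ffun {ffun 'I_n -> F} -> F} :=
  [ffun v : {ffun _ -> _} => (mpoly_of_coeffs c).@[v]].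

Lemma evalcE c (v : {ffun _ -> _}) : evalc c v = \sum_e c e * \prod_i v i ^+ e i.
Proof.
rewrite ffunE raddf_sum; apply: eq_bigr => e _ /=.
rewrite mevalZ mevalX; congr (_ * _).
by apply: eq_bigr => i _; rewrite /expo_mnm mnmE.
Qed.

Lemma evalc_is_zmod_morphism : zmod_morphism evalc.
Proof.
move=> c1 c2; apply/ffunP=> v; rewrite !ffunE -raddfB; congr (_.@[v]).
rewrite /mpoly_of_coeffs -sumrB; apply: eq_bigr => e _.
by rewrite !ffunE scalerBl.
Qed.

HB.instance Definition _ :=
  GRing.isZmodMorphism.Build _ _ evalc evalc_is_zmod_morphism.

(** Multivariate Lagrange interpolation: the coefficient family c collects those
    of the sum over the points u of g u times the indicator of u, a product of
    univariate indicators. *)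
Lemma evalc_surj (g : {ffun {ffun 'I_n -> F} -> F}) :
  (#|F| <= d.+1)%N -> exists c, evalc c = g.
Proof.
move=> le_q_d.
exists [ffun e : {ffun 'I_n -> 'I_d.+1} =>
  \sum_u g u * \prod_i (indicator_poly (u i))`_(e i)].
apply/ffunP => v; rewrite evalcE.
under eq_bigr => e _ do rewrite ffunE mulr_suml.
rewrite exchange_big /=.
have eval_indicator (u : {ffun 'I_n -> F}) :
    \sum_(e : {ffun 'I_n -> 'I_d.+1})
      \prod_i ((indicator_poly (u i))`_(e i) * v i ^+ e i) = (u == v)%:R.
  rewrite -(bigA_distr_bigA (fun i (j : 'I_d.+1) =>
    (indicator_poly (u i))`_j * v i ^+ j)).
  under eq_bigr => i _.
    rewrite -horner_coef_wide ?(leq_trans (size_indicator_poly _)) //.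
    rewrite horner_indicator_poly; over.
  have [<-|ne_uv] := eqVneq u v; first by rewrite big1 // => i _; rewrite eqxx.
  have /existsP[i ne_i] : [exists i, u i != v i].
    apply: contraR ne_uv; rewrite negb_exists => /forallP eq_uv.
    by apply/eqP/ffunP => i; apply/eqP; rewrite -[_ == _]negbK eq_uv.
  by rewrite (bigD1 i) //= (negPf ne_i) mul0r.
rewrite (eq_bigr (fun u => g u * (u == v)%:R)) => [|u _]; last first.
  rewrite -eval_indicator mulr_sumr; apply: eq_bigr => e _.
  by rewrite -mulrA -big_split.
rewrite (bigD1 v) //= eqxx mulr1 big1 ?addr0 // => u /negPf->.
by rewrite mulr0.
Qed.

End Evaluation.

Lemma nzeros_law_random_function (F : finFieldType) (n d k : nat) :
  (#|F| <= d.+1)%N ->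
  nzeros_law F n d k =
    unif_prob (fun g : {ffun {ffun 'I_n -> F} -> F} =>
      #|[set v | g v == 0]| == k).
Proof.
move=> le_q_d.
have coeffs_bij : bijective (@boxpoly_of_coeffs F n d).
  by exists (@boxpoly_coeffs F n d);
    [exact: boxpoly_of_coeffsK | exact: boxpoly_coeffsK].
rewrite /nzeros_law -(unif_prob_bij _ coeffs_bij).
rewrite -(unif_prob_morph (f := @evalc F n d)) => [|g]; last exact: evalc_surj.
rewrite /unif_prob; congr (_%:R / _); apply: eq_card => c; rewrite !inE.
by congr (_ == _); apply: eq_card => v; rewrite !inE ffunE.
Qed.

Theorem proposition4p3 (p r : nat) (F : finFieldType) (n : nat)
    (hp : prime p) (hr : (1 <= r)%N) (hF : #|F| = (p ^ r)%N) (hn : (1 <= n)%N)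
    (d d' : nat) (hd : (p ^ r - 1 <= d)%N) (hd' : (p ^ r - 1 <= d')%N) (k : nat) :
  nzeros_law F n d k = nzeros_law F n d' k.
Proof.
by rewrite !nzeros_law_random_function // hF -add1n -leq_subLR.
Qed.
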